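(* For $0<\delta\le\frac1{10}$, let $\Omega_0=(2-\delta,2+\delta)$ and $\Omega_1=-\Omega_0$, so that $\tfrac12\Omega_0+\tfrac12\Omega_1=B_\delta=(-\delta,\delta)$. Then $$T_\gamma(B_{\delta})>T_\gamma(\Omega_0)=T_\gamma(\Omega_1),$$ so for every $\alpha>0$ the function $t\mapsto T_\gamma\bigl((1-t)\Omega_0+t\Omega_1\bigr)^{\alpha}$ is not convex on $[0,1]$, and neither is $t\mapsto\log T_\gamma\bigl((1-t)\Omega_0+t\Omega_1\bigr)$.
   Context: $\gamma$ is the standard Gaussian measure on $\mathbb{R}$, $d\gamma=(2\pi)^{-1/2}e^{-x^2/2}\,dx$. For a bounded open set $\Omega\subset\mathbb{R}$, the torsion function $u_\Omega$ is the solution of $u''-xu'=-1$ in $\Omega$, $u=0$ on $\partial\Omega$, and $T_\gamma(\Omega)=\int_\Omega u_\Omega\,d\gamma$. The Minkowski combination is $(1-t)\Omega_0+t\Omega_1=\{(1-t)x_0+tx_1:\ x_0\in\Omega_0,\ x_1\in\Omega_1\}$. *)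

(* Defs.v *)
From HB Require Import structures.
From mathcomp Require Import all_boot all_order all_algebra.
From mathcomp Require Import all_classical all_reals all_analysis.
Set Implicit Arguments.
Unset Strict Implicit.
Unset Printing Implicit Defensive.
Import Order.TTheory GRing.Theory Num.Theory.
Import numFieldNormedType.Exports.
Local Open Scope classical_set_scope.
Local Open Scope ring_scope.

(* [u] is only constrained on [closure Om]; its values elsewhere are junk. *)
Definition is_torsion_function (R : realType) (Om : set R) (u : R -> R) : Prop :=
  [/\ {within closure Om, continuous u},
      forall x, Om x ->
        [/\ derivable u x 1, derivable (derive1 u) x 1 &
            derive1 (derive1 u) x - x * derive1 u x = -1]
    & forall x, (closure Om `\` interior Om) x -> u x = 0].

(* For bounded open [Om] the solution exists and is unique on [closure Om], by
   solving on each component of [Om]. *)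
Definition torsion_function (R : realType) (Om : set R) : R -> R :=
  xget (fun=> 0) [set u | is_torsion_function Om u].

(* [normal_prob 0 1] has density [expR (- x ^+ 2 / 2) / Num.sqrt (2 * pi)]. *)
Definition gaussian_torsion (R : realType) (Om : set R) : R :=
  Rintegral (normal_prob (0 : R) 1) Om (torsion_function Om).

Definition minkowski_comb (R : realType) (t : R) (A B : set R) : set R :=
  [set (1 - t) * x0 + t * x1 | x0 in A & x1 in B].

(* Main.v *)
Require Import Defs.
From HB Require Import structures.
From mathcomp Require Import all_boot all_order all_algebra.
From mathcomp Require Import all_classical all_reals all_analysis.
From mathcomp Require Import measurable_realfun ring lra.
Set Implicit Arguments.
Unset Strict Implicit.
Unset Printing Implicit Defensive.
Import Order.TTheory GRing.Theory Num.Theory.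
Import numFieldNormedType.Exports.
Local Open Scope classical_set_scope.
Local Open Scope ring_scope.

(** The operator L u = u'' - x u' is the Ornstein-Uhlenbeck operator, and a
torsion function solves L u = -1 with zero boundary values. For a short interval
of centre c and half-width r, the parabola q(x) = r^2 - (x - c)^2 vanishes at
both ends and satisfies L q = -2 (1 - x (x - c)). If c = 0 or c = 2 and
r <= 1/10, the correction x (x - c) is small, so suitable multiples of q are
sub- and supersolutions, and comparison ([ou_comparison]) bounds the torsion
function by them. After translation, the torsion function of (2 - r, 2 + r) is
thus at most 4/3 times that of (- r, r), whereas the Gaussian density is smaller
on the first interval by a factor of at least exp (9/5) > 32/9. Crude bounds on
the integrals ([gaussian_torsion_le], [gaussian_torsion_ge]), which lose a
factor 8/3, leave enough room to conclude that the interval at the origin has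
the larger torsion.

The comparison principle itself is one-dimensional: exp (- x^2 / 2) z' is
nondecreasing as soon as L z >= 0, so z' cannot be positive and later negative,
and z cannot rise above 0 between two points where it is at most 0. This also
gives uniqueness, hence the invariance of the Gaussian torsion under x |-> - x.

Finally, t |-> (1 - t) Om0 + t Om1 takes the values Om0, (- delta, delta) and
- Om0 at 0, 1/2 and 1. The torsion at 1/2 strictly exceeds the common value at
the ends, and so does any strictly increasing function of it; this contradicts
convexity at the midpoint. For the logarithm, which increases strictly only on
the positive reals, the torsion of Om0 has to be positive as well. *)

(** * Comparison for the Ornstein-Uhlenbeck operator *)

Section OrnsteinUhlenbeck.
Variable R : realType.
Implicit Types (a b c x : R) (u v : R -> R).

Definition ou_operator u x : R := derive1 (derive1 u) x - x * derive1 u x.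

Definition twice_derivable u x : Prop :=
  derivable u x 1 /\ derivable (derive1 u) x 1.

Lemma is_derive_derive1 u x : derivable u x 1 -> is_derive x 1 u (derive1 u x).
Proof. by move=> du; rewrite derive1E; exact/derivableP. Qed.

Lemma is_derive_derive1E u x d : is_derive x 1 u d -> derive1 u x = d.
Proof. by move=> du; rewrite derive1E; exact: derive_val. Qed.

Lemma is_derive_derivable u x d : is_derive x 1 u d -> derivable u x 1.
Proof. by move=> du; exact: ex_derive. Qed.

Lemma is_derive_gauss c x :
  is_derive x 1 (fun y : R => expR (c * y ^+ 2))
    (2 * c * x * expR (c * x ^+ 2)).
Proof.
have H : is_derive x 1 (fun y : R => c * y ^+ 2) (2 * c * x).
  rewrite (_ : (fun y : R => _) = c *: (id ^+ 2))//.
  by apply: is_derive_eq; rewrite /GRing.scale/=; ring.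
rewrite mulrC; exact: (is_derive1_comp (is_derive_expR _) H).
Qed.

(** If z were positive at x, the mean value theorem would give p < x < q with
z'(p) > 0 > z'(q). But exp (- x^2 / 2) z' has the nonnegative derivative
exp (- x^2 / 2) (z'' - x z'), so it cannot change sign from + to -. With z1
and z2 as parameters the lemma applies to a difference u - v, whose derivative
is the difference of the derivatives only where both exist. *)
Lemma ou_max_principle a b (z z1 z2 : R -> R) :
    {within `[a, b], continuous z} ->
    (forall x, x \in `]a, b[ ->
       [/\ is_derive x 1 z (z1 x), is_derive x 1 z1 (z2 x) &
           0 <= z2 x - x * z1 x]) ->
    z a <= 0 -> z b <= 0 ->
  forall x, x \in `[a, b] -> z x <= 0.
Proof.
move=> cz dz za zb x; rewrite in_itv/= => /andP[ax xb].
have [->//|nax] := eqVneq x a; have [->//|nxb] := eqVneq x b.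
have {nax}ax : a < x by rewrite lt_neqAle eq_sym nax.
have {nxb}xb : x < b by rewrite lt_neqAle nxb.
rewrite leNgt; apply/negP => zx0.
have subL y : y \in `]a, x[ -> y \in `]a, b[.
  by rewrite !in_itv/= => /andP[-> /lt_trans]; apply.
have subR y : y \in `]x, b[ -> y \in `]a, b[.
  by rewrite !in_itv/= => /andP[xy ->]; rewrite (lt_trans ax).
have czL : {within `[a, x], continuous z}.
  apply: continuous_subspaceW cz => y /=; rewrite !in_itv/= => /andP[-> yx].
  exact: le_trans (ltW xb).
have czR : {within `[x, b], continuous z}.
  apply: continuous_subspaceW cz => y /=; rewrite !in_itv/= => /andP[xy ->].
  by rewrite (le_trans (ltW ax)).
have dzL y : y \in `]a, x[ -> is_derive y 1 z (z1 y) by move=> /subL/dz[].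
have dzR y : y \in `]x, b[ -> is_derive y 1 z (z1 y) by move=> /subR/dz[].
have [p pax zp] := MVT ax dzL czL.
have [q qxb zq] := MVT xb dzR czR.
have zp0 : 0 < z1 p.
  have : 0 < z1 p * (x - a) by rewrite -zp; lra.
  by rewrite pmulr_lgt0// subr_gt0.
have zq0 : z1 q < 0.
  have : z1 q * (b - x) < 0 by rewrite -zq; lra.
  by rewrite pmulr_llt0// subr_gt0.
have pq : p < q.
  move: pax qxb; rewrite !in_itv/= => /andP[_ px] /andP[+ _].
  exact: lt_trans.
have sub y : y \in `[p, q] -> y \in `]a, b[.
  move: pax qxb; rewrite !in_itv/= => /andP[ap _] /andP[_ qb] /andP[py yq].
  by rewrite (lt_le_trans ap)//= (le_lt_trans yq).
have dw y : y \in `[p, q] ->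
    is_derive y 1 (fun y => expR (- 2^-1 * y ^+ 2) * z1 y)
      (expR (- 2^-1 * y ^+ 2) * (z2 y - y * z1 y)).
  move=> /sub/dz[_ dz1 _].
  apply: (is_derive_eq (is_deriveM (is_derive_gauss (- 2^-1) y) dz1)).
  by rewrite /GRing.scale/=; field.
have : expR (- 2^-1 * p ^+ 2) * z1 p <= expR (- 2^-1 * q ^+ 2) * z1 q.
  apply: (@ger0_derive1_le_cc _ (fun y => expR (- 2^-1 * y ^+ 2) * z1 y) p q).
  - by move=> y /subset_itv_oo_cc/dw ?; exact: ex_derive.
  - move=> y /subset_itv_oo_cc ypq; rewrite (is_derive_derive1E (dw _ ypq)).
    by rewrite mulr_ge0 ?expR_ge0//; have [] := dz _ (sub _ ypq).
  - by apply: derivable_within_continuous => y /dw ?; exact: ex_derive.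
  - by rewrite in_itv/= lexx ltW.
  - by rewrite in_itv/= lexx ltW.
  - exact: ltW.
apply/negP; rewrite -ltNge (@lt_trans _ _ 0)//.
  by rewrite pmulr_rlt0 ?expR_gt0.
by rewrite mulr_gt0 ?expR_gt0.
Qed.

Lemma ou_comparison a b u v :
    {within `[a, b], continuous u} -> {within `[a, b], continuous v} ->
    (forall x, x \in `]a, b[ ->
       [/\ twice_derivable u x, twice_derivable v x &
           ou_operator v x <= ou_operator u x]) ->
    u a <= v a -> u b <= v b ->
  forall x, x \in `[a, b] -> u x <= v x.
Proof.
move=> cu cv uv ua ub x xab; rewrite -subr_le0.
apply: (@ou_max_principle a b (u - v) (derive1 u - derive1 v)
  (derive1 (derive1 u) - derive1 (derive1 v)) _ _ _ _ x xab).
- by move=> y; apply: cvgB; [exact: cu|exact: cv].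
- move=> y /uv[[du ddu] [dv ddv] Luv]; split.
  + exact: is_deriveB (is_derive_derive1 du) (is_derive_derive1 dv).
  + exact: is_deriveB (is_derive_derive1 ddu) (is_derive_derive1 ddv).
  + move: Luv; rewrite /ou_operator !fctE.
    by move: (derive1 (derive1 u) y) (derive1 (derive1 v) y) => ? ?; nra.
- by rewrite !fctE subr_le0.
- by rewrite !fctE subr_le0.
Qed.

Lemma closure_itvoo a b : a < b ->
  closure `]a, b[%classic = `[a, b]%classic :> set R.
Proof.
move=> ab; apply/seteqP; split; first exact: itv_closure.
move=> x /=; rewrite in_itv/= => /andP[].
rewrite le_eqVlt => /predU1P[<- _|ax].
  rewrite closureEcvg; exists (a^'+); first exact: at_right_proper_filter.
  split; first exact: cvg_within.
  move=> A /= H; near=> y; apply: H => /=; rewrite in_itv/=; apply/andP; split.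
    by [].
  by near: y; exact: nbhs_right_lt.
rewrite le_eqVlt => /predU1P[->|xb].
  rewrite closureEcvg; exists (b^'-); first exact: at_left_proper_filter.
  split; first exact: cvg_within.
  move=> A /= H; near=> y; apply: H => /=; rewrite in_itv/=; apply/andP; split.
    by near: y; exact: nbhs_left_gt.
  by [].
by apply: subset_closure; rewrite /= in_itv/= ax.
Unshelve. all: by end_near.
Qed.

Lemma is_torsion_function_itvP a b u : a < b ->
  is_torsion_function `]a, b[%classic u <->
  [/\ {within `[a, b], continuous u},
      forall x, x \in `]a, b[ -> twice_derivable u x /\ ou_operator u x = -1
    & u a = 0 /\ u b = 0].
Proof.
move=> ab; rewrite /is_torsion_function closure_itvoo//.
have /interior_id -> : open (`]a, b[%classic : set R) by exact: itv_open.
have bdE x : (`[a, b]%classic `\` `]a, b[%classic) x <-> x = a \/ x = b.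
  rewrite /= !in_itv/=; split=> [[/andP[ax xb] /negP]|[]->].
  - by rewrite negb_and -!leNgt => /orP[xa|bx]; [left|right]; lra.
  - by rewrite lexx ltW// ltxx.
  - by rewrite lexx ltW// ltxx andbF.
split=> [[cu Lu u0]|[cu Lu [ua ub]]]; split => //.
- by move=> x /Lu[].
- by split; apply: u0; apply/bdE; [left|right].
- by move=> x /Lu[[]].
- by move=> x /bdE[] ->.
Qed.

Lemma torsion_function_unique a b u v : a < b ->
    is_torsion_function `]a, b[%classic u ->
    is_torsion_function `]a, b[%classic v ->
  forall x, x \in `[a, b] -> u x = v x.
Proof.
move=> ab /(is_torsion_function_itvP _ ab)[cu Lu [ua ub]].
move=> /(is_torsion_function_itvP _ ab)[cv Lv [va vb]] x xab.
apply/eqP; rewrite eq_le; apply/andP; split; apply: ou_comparison xab => //.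
- by move=> y yab; have [? ->] := Lu _ yab; have [? ->] := Lv _ yab.
- by rewrite ua va.
- by rewrite ub vb.
- by move=> y yab; have [? ->] := Lu _ yab; have [? ->] := Lv _ yab.
- by rewrite ua va.
- by rewrite ub vb.
Qed.

End OrnsteinUhlenbeck.

(** * Existence of the torsion function of an interval *)

Section Existence.
Variable R : realType.
Implicit Types (a b x : R).

(** The derivative is only claimed on the open interval, so iterated primitives
have to be taken on shrinking intervals. *)
Lemma primitive_itv a b (f : R -> R) : a < b ->
    {within `[a, b], continuous f} ->
  exists F : R -> R, forall x, x \in `]a, b[ -> is_derive x 1 F (f x).
Proof.
move=> ab cf; exists (fun x => \int[lebesgue_measure]_(t in `[a, x]) f t).
have intf : lebesgue_measure.-integrable `[a, b] (EFin \o f).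
  by apply: continuous_compact_integrable => //; exact: segment_compact.
move/(continuous_within_itvP _ ab) : (cf) => [cfo _ _].
move=> x xab; have /andP[ax xb] : a < x < b by move: xab; rewrite in_itv.
have [dF <-] := continuous_FTC1_closed xb intf ax (cfo _ xab).
exact: is_derive_derive1.
Qed.

(** The equation reads (phi u')' = - phi with phi = exp (- x^2 / 2). With
F' = phi and h = 1 / phi it integrates to u' = (C - F) h, so u is C H - L up to a
constant, where H' = h and L' = F h. The constant C is fixed by u b = 0; this is
possible because H is strictly increasing. *)
Lemma torsion_function_exists a b : a < b ->
  exists u, is_torsion_function `]a, b[%classic u.
Proof.
move=> ab.
pose phi y := expR (- 2^-1 * y ^+ 2) : R; pose h y := expR (2^-1 * y ^+ 2) : R.
have dphi x : is_derive x 1 phi (- x * phi x).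
  by apply: (is_derive_eq (is_derive_gauss _ _)); rewrite /phi; field.
have dh x : is_derive x 1 h (x * h x).
  by apply: (is_derive_eq (is_derive_gauss _ _)); rewrite /h; field.
have phih x : phi x * h x = 1 by rewrite /phi /h -expRD mulNr addNr expR0.
have h0 x : 0 < h x by exact: expR_gt0.
clearbody phi h.
(* F lives on a larger neighbourhood of the closed interval than H and L, because
   it has to be continuous where L is a primitive of F h. *)
have [F dF] : exists F : R -> R,
    forall x, x \in `]a - 2, b + 2[ -> is_derive x 1 F (phi x).
  apply: primitive_itv; first lra.
  apply: derivable_within_continuous => x _.
  exact: is_derive_derivable (dphi x).
have [H dH] : exists H : R -> R,
    forall x, x \in `]a - 1, b + 1[ -> is_derive x 1 H (h x).
  apply: primitive_itv; first lra.
  apply: derivable_within_continuous => x _.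
  exact: is_derive_derivable (dh x).
have [L dL] : exists L : R -> R,
    forall x, x \in `]a - 1, b + 1[ -> is_derive x 1 L (F x * h x).
  apply: primitive_itv; first lra.
  apply: derivable_within_continuous => x; rewrite in_itv/= => /andP[? ?].
  apply: derivableM; last exact: is_derive_derivable (dh x).
  by apply: is_derive_derivable (dF x _); rewrite in_itv/=; lra.
have sub x : x \in `]a, b[ -> x \in `]a - 1, b + 1[.
  by rewrite !in_itv/= => ?; lra.
have subc x : x \in `[a, b] -> x \in `]a - 1, b + 1[.
  by rewrite !in_itv/= => ?; lra.
have Hab : H b - H a != 0.
  have dHab x : x \in `]a, b[ -> is_derive x 1 H (h x) by move=> /sub/dH.
  have cH : {within `[a, b], continuous H}.
    by apply: derivable_within_continuous => x /subc/dH/is_derive_derivable.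
  have [x _ ->] := MVT ab dHab cH.
  by rewrite mulf_neq0 ?gt_eqF// subr_gt0.
pose C := (L b - L a) / (H b - H a).
pose u x := C * (H x - H a) - (L x - L a).
have du x : x \in `]a - 1, b + 1[ -> is_derive x 1 u ((C - F x) * h x).
  move=> xab; have ? := dH _ xab; have ? := dL _ xab.
  rewrite (_ : u = C *: (H - cst (H a)) - (L - cst (L a)))//.
  by apply: is_derive_eq; rewrite /GRing.scale/=; ring.
exists u; apply/(is_torsion_function_itvP _ ab); split.
- by apply: derivable_within_continuous => x /subc/du/is_derive_derivable.
- move=> x xab.
  have ddu : is_derive x 1 (derive1 u) (x * ((C - F x) * h x) - 1).
    have dFx : is_derive x 1 F (phi x).
      by apply: dF; move: xab; rewrite !in_itv/= => ?; lra.
    have : is_derive x 1 ((cst C - F) * h) (x * ((C - F x) * h x) - 1).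
      have := is_deriveM (is_deriveB (is_derive_cst C x 1) dFx) (dh x).
      move/is_derive_eq; apply; rewrite -[in RHS](phih x) /GRing.scale/= !fctE.
      ring.
    apply: near_eq_is_derive; near=> y; apply/esym/is_derive_derive1E/du/sub.
    by near: y; exact: near_in_itvoo.
  split.
    split; first exact: is_derive_derivable (du x (sub x xab)).
    exact: is_derive_derivable ddu.
  rewrite /ou_operator (is_derive_derive1E ddu).
  by rewrite (is_derive_derive1E (du x (sub x xab))); ring.
- by split; rewrite /u /C; field.
Unshelve. all: by end_near.
Qed.

Lemma torsion_functionP a b : a < b ->
  is_torsion_function `]a, b[%classic (torsion_function `]a, b[%classic).
Proof. by move=> ab; apply: xgetPex; exact: torsion_function_exists. Qed.

End Existence.

(** * Parabolic barriers and reflection *)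

Section Barriers.
Variable R : realType.
Implicit Types (a b c k r x : R) (u : R -> R).

Definition parabola k c r x : R := k * (r ^+ 2 - (x - c) ^+ 2).

Lemma is_derive_parabola k c r x :
  is_derive x 1 (parabola k c r) (- (2 * k) * (x - c)).
Proof.
rewrite (_ : parabola k c r = k *: (cst (r ^+ 2) - (id - cst c) ^+ 2))//.
by apply: is_derive_eq; rewrite /GRing.scale/= !fctE; ring.
Qed.

Lemma derive1_parabola k c r :
  derive1 (parabola k c r) = fun x => - (2 * k) * (x - c).
Proof. by apply/funext => x; exact/is_derive_derive1E/is_derive_parabola. Qed.

Lemma is_derive_derive1_parabola k c r x :
  is_derive x 1 (derive1 (parabola k c r)) (- (2 * k)).
Proof.
rewrite derive1_parabola.
rewrite (_ : (fun x => _) = (- (2 * k)) *: (id - cst c))//.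
by apply: is_derive_eq; rewrite /GRing.scale/= subr0 mulr1.
Qed.

Lemma twice_derivable_parabola k c r x : twice_derivable (parabola k c r) x.
Proof.
split; first exact: is_derive_derivable (is_derive_parabola k c r x).
exact: is_derive_derivable (is_derive_derive1_parabola k c r x).
Qed.

Lemma ou_operator_parabola k c r x :
  ou_operator (parabola k c r) x = - (2 * k * (1 - x * (x - c))).
Proof.
rewrite /ou_operator (is_derive_derive1E (is_derive_derive1_parabola k c r x)).
by rewrite (is_derive_derive1E (is_derive_parabola k c r x)); ring.
Qed.

Lemma within_continuous_parabola k c r a b :
  {within `[a, b], continuous (parabola k c r)}.
Proof.
apply: derivable_within_continuous => x _.
exact: is_derive_derivable (is_derive_parabola k c r x).
Qed.

(** The hypothesis says - L q <= 1 for the parabola q, so that q is a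
subsolution; the next lemma is the same for supersolutions. *)
Lemma parabola_le_torsion k c r u : 0 < r ->
    is_torsion_function `]c - r, c + r[%classic u ->
    (forall x, x \in `]c - r, c + r[ -> 2 * k * (1 - x * (x - c)) <= 1) ->
  forall x, x \in `[c - r, c + r] -> parabola k c r x <= u x.
Proof.
move=> r0 + kr; have ab : c - r < c + r by lra.
move/(is_torsion_function_itvP _ ab) => [cu Lu [ua ub]] x.
apply: ou_comparison => //; first exact: within_continuous_parabola.
- move=> y yI; have [du ->] := Lu _ yI.
  split; [exact: twice_derivable_parabola|exact: du|].
  by rewrite ou_operator_parabola lerN2 kr.
- by rewrite ua /parabola (_ : r ^+ 2 - _ = 0) ?mulr0//; ring.
- by rewrite ub /parabola (_ : r ^+ 2 - _ = 0) ?mulr0//; ring.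
Qed.

Lemma torsion_le_parabola k c r u : 0 < r ->
    is_torsion_function `]c - r, c + r[%classic u ->
    (forall x, x \in `]c - r, c + r[ -> 1 <= 2 * k * (1 - x * (x - c))) ->
  forall x, x \in `[c - r, c + r] -> u x <= parabola k c r x.
Proof.
move=> r0 + kr; have ab : c - r < c + r by lra.
move/(is_torsion_function_itvP _ ab) => [cu Lu [ua ub]] x.
apply: ou_comparison => //; first exact: within_continuous_parabola.
- move=> y yI; have [du ->] := Lu _ yI.
  split; [exact: du|exact: twice_derivable_parabola|].
  by rewrite ou_operator_parabola lerN2 kr.
- by rewrite ua /parabola (_ : r ^+ 2 - _ = 0) ?mulr0//; ring.
- by rewrite ub /parabola (_ : r ^+ 2 - _ = 0) ?mulr0//; ring.
Qed.

(** The drift x u' is even under reflection, since both x and u' change sign. *)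
Lemma is_torsion_functionN a b u : a < b ->
    is_torsion_function `]a, b[%classic u ->
  is_torsion_function `]- b, - a[%classic (u \o -%R).
Proof.
move=> ab /(is_torsion_function_itvP _ ab)[cu Lu [ua ub]].
have ab' : - b < - a by rewrite ltrN2.
have oppI x : x \in `]- b, - a[ -> - x \in `]a, b[.
  by rewrite !in_itv/= => ?; lra.
have dN x : is_derive x 1 (-%R : R -> R) (-1).
  exact: is_deriveN (is_derive_id _ _).
have du x : x \in `]- b, - a[ -> is_derive x 1 (u \o -%R) (- derive1 u (- x)).
  move=> /oppI/Lu[[du _] _].
  have := is_derive1_comp (is_derive_derive1 du) (dN x).
  by rewrite mulrN1.
apply/(is_torsion_function_itvP _ ab'); split.
- move/(continuous_within_itvP _ ab) : cu => [cuo cua cub].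
  apply/(continuous_within_itvP _ ab'); split.
  + move=> x /du dux; apply/differentiable_continuous/derivable1_diffP.
    exact: is_derive_derivable dux.
  + by rewrite /= opprK; apply/cvg_at_leftNP.
  + by rewrite /= opprK; apply/cvg_at_rightNP.
- move=> x xI; have [[_ ddu] Lux] := Lu _ (oppI _ xI).
  have {}ddu : is_derive x 1 (derive1 (u \o -%R)) (derive1 (derive1 u) (- x)).
    have := is_deriveN (is_derive1_comp (is_derive_derive1 ddu) (dN x)).
    rewrite mulrN1 opprK; apply: near_eq_is_derive.
    near=> y; apply/esym/is_derive_derive1E/du.
    by near: y; exact: near_in_itvoo.
  split.
    split; first exact: is_derive_derivable (du _ xI).
    exact: is_derive_derivable ddu.
  rewrite -Lux /ou_operator (is_derive_derive1E ddu).
  by rewrite (is_derive_derive1E (du _ xI)); ring.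
- by rewrite /= !opprK.
Unshelve. all: by end_near.
Qed.

End Barriers.

(** * Gaussian torsion as a Lebesgue integral *)

Section GaussianTorsion.
Variable R : realType.
Implicit Types (a b c k m M r x : R) (u : R -> R).
Local Notation mu := (@lebesgue_measure R).
Local Notation gamma := (normal_prob (0 : R) 1).
Local Notation pdf := (normal_pdf (0 : R) 1).

(** Both the density and the Radon-Nikodym derivative integrate to the normal law
on every measurable set, so they agree almost everywhere. *)
Lemma integral_normal_prob (D : set (measurableTypeR R))
    (f : measurableTypeR R -> \bar R) :
    measurable D -> gamma.-integrable D f ->
  (\int[gamma]_(x in D) f x = \int[mu]_(x in D) (f x * (pdf x)%:E))%E.
Proof.
move=> mD intf; have dom := @normal_prob_dominates R 0 1.
rewrite -(Radon_Nikodym_change_of_variables dom mD intf).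
have mf := measurable_int _ intf.
have iRN := @Radon_Nikodym_integrable _ _ _
  (charge_of_finite_measure gamma) mu dom.
have mpdf : measurable_fun D (fun x => (pdf x)%:E).
  apply/measurable_EFinP; apply: measurable_funTS; exact: measurable_normal_pdf.
have mRN := measurable_int _ (integrableS measurableT mD (@subsetT _ D) iRN).
apply: ae_eq_integral => //; [exact: emeasurable_funM|exact: emeasurable_funM|].
apply: ae_eqe_mul2l; apply: integral_ae_eq => //.
  exact: integrableS iRN.
by move=> E _ mE; rewrite -Radon_Nikodym_integral.
Qed.

Lemma pdfE x : pdf x = normal_peak 1 * expR (- 2^-1 * x ^+ 2).
Proof.
rewrite normal_pdfE ?oner_neq0// /normal_fun subr0 expr1n; congr (_ * expR _).
by field.
Qed.

Lemma within_continuous_pdfM a b u : {within `[a, b], continuous u} ->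
  {within `[a, b], continuous (fun x => u x * pdf x)}.
Proof.
move=> cu; have cpdf : {within `[a, b], continuous pdf}.
  exact/continuous_subspaceT/continuous_normal_pdf/oner_neq0.
by move=> x; apply: cvgM; [exact: cu|exact: cpdf].
Qed.

Lemma within_continuous_integrable a b u : {within `[a, b], continuous u} ->
  mu.-integrable `[a, b] (EFin \o u).
Proof.
move=> cu; apply: continuous_compact_integrable => //; exact: segment_compact.
Qed.

Lemma Rintegral_normal_prob a b u : {within `[a, b], continuous u} ->
  \int[gamma]_(x in `]a, b[) u x = \int[mu]_(x in `[a, b]) (u x * pdf x).
Proof.
move=> cu; have sub : `]a, b[ `<=` `[a, b] by apply: subset_itv_oo_cc.
have mu_u : measurable_fun `]a, b[%classic u.
  apply: (measurable_funS _ sub) => //; apply/measurable_EFinP.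
  exact: measurable_int (within_continuous_integrable cu).
have intu : gamma.-integrable `]a, b[ (EFin \o u).
  apply: measurable_bounded_integrable => //.
    by apply: (le_lt_trans (probability_le1 _ _)) => //; exact: ltry.
  have /compact_bounded := continuous_compact cu (@segment_compact _ a b).
  move=> [M [Mr uM]]; exists M; split => // N MN x xab.
  by apply: uM => //; exists x => //; exact: sub.
rewrite /Rintegral integral_normal_prob//; congr fine.
rewrite -(integral_itv_bndoo true false)//.
apply/measurable_EFinP; apply: measurable_funM => //.
by apply: measurable_funTS; exact: measurable_normal_pdf.
Qed.

(** Uniqueness makes the chosen torsion function irrelevant; the closed interval
and the continuous integrand suit both substitution and constant bounds. *)
Lemma gaussian_torsionE a b u : a < b ->
    is_torsion_function `]a, b[%classic u ->
  gaussian_torsion `]a, b[%classic = \int[mu]_(x in `[a, b]) (u x * pdf x).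
Proof.
move=> ab tu; have tt := torsion_functionP ab.
have [ct _ _] := (is_torsion_function_itvP _ ab).1 tt.
rewrite /gaussian_torsion (Rintegral_normal_prob ct); apply: eq_Rintegral => x.
by rewrite inE => xab; rewrite (torsion_function_unique ab tt tu xab).
Qed.

Lemma gaussian_torsionN a b : a < b ->
  gaussian_torsion `]- b, - a[%classic =
  gaussian_torsion (`]a, b[%classic : set R).
Proof.
move=> ab; have [u tu] := torsion_function_exists ab.
have ab' : - b < - a by rewrite ltrN2.
have tN := is_torsion_functionN ab tu.
rewrite (gaussian_torsionE ab tu) (gaussian_torsionE ab' tN).
have [cN _ _] := (is_torsion_function_itvP _ ab').1 tN.
rewrite /Rintegral (integration_by_substitution_oppr (ltW ab)); last first.
  exact: within_continuous_pdfM.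
congr fine; apply: eq_integral => x _ /=.
by rewrite opprK !pdfE sqrrN.
Qed.

(** The integrand is at most k r^2 M, the maximum of the barrier times the bound
on the density, over an interval of length 2 r. *)
Lemma gaussian_torsion_le c r k M : 0 < r -> 0 <= k ->
    (forall x, x \in `]c - r, c + r[ -> 1 <= 2 * k * (1 - x * (x - c))) ->
    (forall x, x \in `[c - r, c + r] -> pdf x <= M) ->
  gaussian_torsion `]c - r, c + r[%classic <= 2 * k * M * r ^+ 3.
Proof.
move=> r0 k0 kr pM; have ab : c - r < c + r by lra.
have tu := torsion_functionP ab; rewrite (gaussian_torsionE ab tu).
have [cu _ _] := (is_torsion_function_itvP _ ab).1 tu.
have upper := torsion_le_parabola r0 tu kr.
set u := torsion_function _ in tu cu upper *.
have -> : 2 * k * M * r ^+ 3 = \int[mu]_(x in `[c - r, c + r]) (k * r ^+ 2 * M).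
  rewrite Rintegral_cst//= lebesgue_measure_itv/= lte_fin ab -EFinB/=; ring.
apply: le_Rintegral => //.
- exact/within_continuous_integrable/within_continuous_pdfM.
- by apply: within_continuous_integrable => x; exact: cvg_cst.
- move=> x xab; have ux := upper x xab; have px := pM x xab.
  have p0 : 0 <= pdf x by exact: normal_pdf_ge0.
  apply: (@le_trans _ _ (k * r ^+ 2 * pdf x)); last first.
    by rewrite ler_wpM2l// mulr_ge0// sqr_ge0.
  rewrite ler_wpM2r// (le_trans ux)// /parabola ler_wpM2l//.
  by rewrite lerBlDr lerDl sqr_ge0.
Qed.

(** On the middle half, of length r, the barrier is at least 3/4 of its maximum
k r^2; the rest of the integral is nonnegative. *)
Lemma gaussian_torsion_ge c r k m : 0 < r -> 0 <= k -> 0 <= m ->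
    (forall x, x \in `]c - r, c + r[ -> 2 * k * (1 - x * (x - c)) <= 1) ->
    (forall x, x \in `[c - r, c + r] -> m <= pdf x) ->
  3 / 4 * k * m * r ^+ 3 <= gaussian_torsion `]c - r, c + r[%classic.
Proof.
move=> r0 k0 m0 kr mp; have ab : c - r < c + r by lra.
have tu := torsion_functionP ab; rewrite (gaussian_torsionE ab tu).
have [cu _ _] := (is_torsion_function_itvP _ ab).1 tu.
have lower := parabola_le_torsion r0 tu kr.
set u := torsion_function _ in tu cu lower *.
have iu : mu.-integrable `[c - r, c + r] (EFin \o (fun x => u x * pdf x)).
  exact/within_continuous_integrable/within_continuous_pdfM.
pose J : set R := `[c - r / 2, c + r / 2]%classic.
have JI : J `<=` `[c - r, c + r].
  by move=> x; rewrite /J /= !in_itv/= => ?; lra.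
have mJ : measurable (J : set (measurableTypeR R)) by exact: measurable_itv.
have muJ : mu J = r%:E.
  rewrite lebesgue_measure_itv/= lte_fin ifT; last lra.
  by rewrite -EFinB; congr EFin; field.
have -> : 3 / 4 * k * m * r ^+ 3 = \int[mu]_(x in J) (3 / 4 * k * r ^+ 2 * m).
  by rewrite Rintegral_cst//= muJ/=; field.
have iuJ : mu.-integrable J (EFin \o (fun x => u x * pdf x)).
  exact: integrableS iu.
apply: (@le_trans _ _ (\int[mu]_(x in J) (u x * pdf x))).
  apply: le_Rintegral => //.
    by apply: within_continuous_integrable => x; exact: cvg_cst.
  move=> x xJ; have xI := JI x xJ; apply: ler_pM => //; last exact: mp.
    by apply: mulr_ge0 (sqr_ge0 r); apply: mulr_ge0.
  apply: le_trans (lower _ xI); rewrite /parabola mulrAC [_ * k]mulrC.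
  rewrite -mulrA ler_wpM2l//; move: xJ; rewrite /J /= in_itv/= => /andP[? ?].
  nra.
apply: fine_le; [exact: integrable_fin_num|exact: integrable_fin_num|].
apply: ge0_subset_integral => //; first exact: measurable_int iu.
move=> x xI; rewrite lee_fin mulr_ge0 ?normal_pdf_ge0//.
apply: le_trans (lower _ xI); rewrite /parabola mulr_ge0//.
by move: xI; rewrite /= in_itv/= => /andP[? ?]; nra.
Qed.

End GaussianTorsion.

(** * Midpoint obstruction to convexity *)

Section Convexity.
Variable R : realType.

Lemma minkowski_comb0 (A B : set R) : B !=set0 -> minkowski_comb 0 A B = A.
Proof.
move=> [y By]; apply/seteqP; split=> [_ [x Ax [z _ <-]]|x Ax].
  by rewrite subr0 mul1r mul0r addr0.
by exists x => //; exists y => //; rewrite subr0 mul1r mul0r addr0.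
Qed.

Lemma minkowski_comb1 (A B : set R) : A !=set0 -> minkowski_comb 1 A B = B.
Proof.
move=> [x Ax]; apply/seteqP; split=> [_ [z _ [y By <-]]|y By].
  by rewrite subrr mul0r mul1r add0r.
by exists x => //; exists y => //; rewrite subrr mul0r mul1r add0r.
Qed.

Lemma not_convex_midpoint (f : R -> R) : f 1 = f 0 -> f 0 < f 2^-1 ->
  ~ convex_function (`[0, 1]%classic : set R^o) f.
Proof.
move=> f10 f0h cf.
have h0 : 0 <= 2^-1 :> R by rewrite invr_ge0.
have h1 : 2^-1 <= 1 :> R by rewrite invf_le1// ler1n.
have := cf (Itv01 h0 h1) 0 1; rewrite !inE/= !in_itv/= !lexx ler01.
move=> /(_ isT isT); rewrite f10 convmm leNgt.
have -> : conv (Itv01 h0 h1) (0 : convex_lmodType R^o) 1 = 2^-1 :> R.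
  apply: (etrans (convRE 0 1 (Itv01 h0 h1))).
  by rewrite /= /unstable.onem; field.
by rewrite f0h.
Qed.

End Convexity.

(** * Torsion of short intervals *)

Section SmallIntervals.
Variable R : realType.
Local Notation pdf := (normal_pdf (0 : R) 1).

(** A quarter of the parabola r^2 - (x - c)^2 is a subsolution when
x (x - c) >= -1, and the density is bounded below on a bounded interval. *)
Lemma gaussian_torsion_small_gt0 (c r : R) :
    0 < r -> (forall x, x \in `]c - r, c + r[ -> - 1 <= x * (x - c)) ->
  0 < gaussian_torsion `]c - r, c + r[%classic.
Proof.
move=> r0 xc.
pose m := normal_peak 1 * expR (- 2^-1 * (`|c| + r) ^+ 2).
have m0 : 0 < m by rewrite mulr_gt0 ?expR_gt0 ?normal_peak_gt0 ?oner_neq0.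
have k0 : 0 <= 4^-1 :> R by rewrite invr_ge0.
have kr x : x \in `]c - r, c + r[ -> 2 * 4^-1 * (1 - x * (x - c)) <= 1.
  by move=> /xc; lra.
have mp x : x \in `[c - r, c + r] -> m <= pdf x.
  rewrite in_itv/= => /andP[? ?]; rewrite pdfE ler_wpM2l ?normal_peak_ge0//.
  rewrite ler_expR ler_wnM2l// ?oppr_le0 ?invr_ge0//.
  rewrite -[x ^+ 2]real_normK ?num_real//.
  have xcr : `|x| <= `|c| + r.
    rewrite -[x in `|x|](subrKC c) (le_trans (ler_normD _ _))// lerD2l.
    by rewrite ler_norml; lra.
  by rewrite ler_sqr ?nnegrE// (le_trans _ xcr).
apply: lt_le_trans (gaussian_torsion_ge r0 k0 (ltW m0) kr mp).
by rewrite mulr_gt0 ?exprn_gt0// mulr_gt0.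
Qed.

(** 32/9 = (4/3) / (3/8) is the ratio of the constants in the two torsion bounds;
9/5 = 361/200 - 1/200 is the gap between the exponents x^2 / 2 at the points
closest to each other, 19/10 and 1/10. *)
Lemma expR_9_5_gt : 32 / 9 < expR (9 / 5 : R).
Proof.
have -> : 9 / 5 = 9 / 10 + 9 / 10 :> R by field.
have := expR_ge1Dx (9 / 10 : R).
by rewrite expRD => ?; nra.
Qed.

(** On (2 - r, 2 + r) one has x (x - 2) <= 21/100, so k = 2/3 gives a
supersolution, and x >= 19/10 bounds the density by a multiple of
e = exp (- 361/200). On (- r, r) the choice k = 1/2 gives a subsolution because
x^2 >= 0, and |x| <= 1/10 bounds the density from below by the same multiple of
exp (- 1/200) = e exp (9/5). The interval at the origin is written with its
centre so that both intervals have the same form. *)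
Lemma gaussian_torsion_shift_lt (r : R) : 0 < r -> r <= 10^-1 ->
  gaussian_torsion `]2 - r, 2 + r[%classic <
  gaussian_torsion `]0 - r, 0 + r[%classic.
Proof.
move=> r0 r10; have {}r10 : r <= 1 / 10 by rewrite div1r.
have p0 : 0 < normal_peak 1 :> R by rewrite normal_peak_gt0 ?oner_neq0.
pose e := expR (- (361 / 200)) : R.
have e0 : 0 < e by exact: expR_gt0.
have upper : gaussian_torsion `]2 - r, 2 + r[%classic <=
    2 * (2 / 3) * (normal_peak 1 * e) * r ^+ 3.
  apply: gaussian_torsion_le => //.
  - by move=> x; rewrite in_itv/= => /andP[? ?]; nra.
  - move=> x; rewrite in_itv/= => /andP[? ?]; rewrite pdfE ler_pM2l//.
    by rewrite ler_expR; nra.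
have lower : 3 / 4 * 2^-1 * (normal_peak 1 * (e * expR (9 / 5))) * r ^+ 3 <=
    gaussian_torsion `]0 - r, 0 + r[%classic.
  apply: gaussian_torsion_ge => //.
  - by rewrite !mulr_ge0 ?expR_ge0// ltW.
  - by move=> x _; rewrite subr0; have := sqr_ge0 x; rewrite expr2; lra.
  - move=> x; rewrite in_itv/= => /andP[? ?]; rewrite pdfE ler_pM2l//.
    by rewrite -expRD ler_expR; nra.
apply: (le_lt_trans upper); apply: lt_le_trans lower.
rewrite ltr_pM2r ?exprn_gt0//.
rewrite (_ : 2 * _ * _ = (normal_peak 1 * e) * (4 / 3)); last by field.
rewrite [ltRHS](_ : _ = (normal_peak 1 * e) * (3 / 8 * expR (9 / 5))).
  by rewrite ltr_pM2l ?mulr_gt0//; have := expR_9_5_gt; lra.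
by field.
Qed.

Lemma minkowski_comb_half_opp (c r : R) :
  minkowski_comb 2^-1 `]c - r, c + r[%classic `]- (c + r), - (c - r)[%classic =
  `]- r, r[%classic.
Proof.
apply/seteqP; split=> [_ [x] + [y] + <-|x].
  by rewrite /= !in_itv/= => /andP[? ?] /andP[? ?]; apply/andP; split; lra.
rewrite /= in_itv/= => /andP[? ?].
exists (c + x); first by rewrite /= in_itv/=; lra.
by exists (x - c); [rewrite /= in_itv/=; lra|field].
Qed.

End SmallIntervals.

Theorem proposition5p4 (R : realType) (delta : R)
    (delta_gt0 : 0 < delta) (delta_le : delta <= 10^-1) :
  let Om0 : set R := `]2 - delta, 2 + delta[%classic in
  let Om1 : set R := [set - x | x in Om0] in
  let Bd : set R := `]- delta, delta[%classic in
  [/\ minkowski_comb 2^-1 Om0 Om1 = Bd,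
      gaussian_torsion Bd > gaussian_torsion Om0,
      gaussian_torsion Om0 = gaussian_torsion Om1,
      forall alpha : R, 0 < alpha ->
        ~ convex_function (`[0, 1]%classic : set R^o)
            (fun t : R => gaussian_torsion (minkowski_comb t Om0 Om1) `^ alpha)
    & ~ convex_function (`[0, 1]%classic : set R^o)
          (fun t : R => ln (gaussian_torsion (minkowski_comb t Om0 Om1)))].
Proof.
move=> Om0 Om1 Bd.
have Om1E : Om1 = `]- (2 + delta), - (2 - delta)[%classic by exact: opp_itvoo.
have hd : minkowski_comb 2^-1 Om0 Om1 = Bd.
  by rewrite Om1E; exact: minkowski_comb_half_opp.
have d10 : delta <= 1 / 10 by rewrite div1r.
have torsionN : gaussian_torsion Om1 = gaussian_torsion Om0.
  by rewrite Om1E; apply: gaussian_torsionN; lra.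
have torsion0 : 0 < gaussian_torsion Om0.
  apply: gaussian_torsion_small_gt0 => // x.
  by rewrite in_itv/= => /andP[? ?]; nra.
have torsion_lt : gaussian_torsion Om0 < gaussian_torsion Bd.
  by have := gaussian_torsion_shift_lt delta_gt0 delta_le; rewrite sub0r add0r.
have torsionB := lt_trans torsion0 torsion_lt.
have Om00 : Om0 2 by rewrite /Om0 /= in_itv/= ltrBlDr !ltrDl delta_gt0.
have at0 : minkowski_comb 0 Om0 Om1 = Om0.
  by apply: minkowski_comb0; exists (- 2); exists 2.
have at1 : minkowski_comb 1 Om0 Om1 = Om1.
  by apply: minkowski_comb1; exists 2.
split => // [alpha alpha_gt0|].
- apply: not_convex_midpoint; rewrite ?at0 ?at1 ?hd ?torsionN//.
  have nneg0 : gaussian_torsion Om0 \is Num.nneg.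
    by rewrite nnegrE (ltW torsion0).
  have nnegB : gaussian_torsion Bd \is Num.nneg.
    by rewrite nnegrE (ltW torsionB).
  exact: (gt0_ltr_powR alpha_gt0 nneg0 nnegB torsion_lt).
- apply: not_convex_midpoint; rewrite ?at0 ?at1 ?hd ?torsionN//.
  by rewrite (ltr_ln torsion0 torsionB).
Qed.
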